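(* Let $\mathbb{K}$ be a field, $S=\mathbb{K}[x_1,\dots,x_n]$, and let $I$ be an integrally closed monomial ideal in $S$. Then for every integer $m\geq 1$, we have $${\rm Ass}(S/I)\subseteq {\rm Ass}(S/I^m).$$
   Context: An ideal $I$ is integrally closed if $I=\overline{I}$, where $\overline{I}$ is the integral closure of $I$; for a monomial ideal $I$, $\overline{I}$ is the monomial ideal generated by all monomials $u\in S$ such that $u^r\in I^r$ for some integer $r\geq 1$. ${\rm Ass}(S/I)$ denotes the set of associated primes of the $S$-module $S/I$. *)

(* Defs.v *)
From HB Require Import structures.
From mathcomp Require Import all_boot all_order all_algebra.
From mathcomp Require Import boolp classical_sets.
From mathcomp Require Import mpoly.

Set Implicit Arguments.
Unset Strict Implicit.
Unset Printing Implicit Defensive.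

Import GRing.Theory.

Local Open Scope classical_set_scope.
Local Open Scope ring_scope.

(* Subsets of a ring are Prop-valued (set R), as membership in an ideal need
   not be decidable; \in is the associated classical boolean membership. *)

Section Ideals.
Variable R : comNzRingType.
Implicit Types (G I J P : set R) (f g : R) (m : nat).

(* Same closure conditions as idealr_closed, but without 1 \notin J: the unit
   ideal is an ideal here. *)
Definition is_ideal J : Prop :=
  0 \in J /\ (forall a, {in J &, forall u v, a * u + v \in J}).

Definition ideal_gen G : set R := smallest is_ideal G.

(* For m = 0 the only product is 1, so ideal_pow I 0 is the unit ideal. *)
Definition ideal_pow I m : set R :=
  ideal_gen [set f | exists2 h : 'I_m -> R,
                       (forall i, I (h i)) & f = \prod_(i < m) h i].

(* idealr_closed includes properness. *)
Definition is_prime_ideal P : Prop :=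
  idealr_closed [pred x in P] /\ prime_idealr_closed [pred x in P].

(* The annihilator in R of the element f + I of the R-module R / I. *)
Definition ann_quot I f : set R := [set g | I (g * f)].

(* Ass (R / I): the primes that are annihilators of an element of R / I; every
   element of R / I is the class f + I of some f. *)
Definition Ass_quot I : set (set R) :=
  [set P | is_prime_ideal P /\ exists f, P = ann_quot I f].

End Ideals.

Section MonomialIdeals.
Variables (K : fieldType) (n : nat).
Implicit Types I : set {mpoly K[n]}.

Definition monomial_gen (A : set 'X_{1..n}) : set {mpoly K[n]} :=
  ideal_gen [set 'X_[K, u] | u in A].

Definition is_monomial_ideal I : Prop := exists A, I = monomial_gen A.

(* The integral closure of a monomial ideal. *)
Definition integral_closure I : set {mpoly K[n]} :=
  monomial_gen
    [set u | exists2 r : nat, (1 <= r)%N & ideal_pow I r ('X_[K, u] ^+ r)].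

Definition integrally_closed I : Prop := I = integral_closure I.

End MonomialIdeals.

(* Main.v *)
Require Import Defs.
From HB Require Import structures.
From mathcomp Require Import all_boot all_order all_algebra.
From mathcomp Require Import boolp classical_sets.
From mathcomp Require Import mpoly.
From mathcomp Require Import zify.

Set Implicit Arguments.
Unset Strict Implicit.
Unset Printing Implicit Defensive.

Import GRing.Theory.

Local Open Scope classical_set_scope.

(** Write P = (I : f).  Since I is monomial, P is generated by monomials
    ([prime_ann_mspan]), and f can be replaced by one of its monomials v: for
    every b, v x^b lies in I exactly when x^b lies in P
    ([prime_ann_monomial]).  Let D be the set of exponents of the monomials
    outside P; as P is prime, D contains 0 and is stable under addition.

    The case I = 0 being clear, suppose I nonzero.
    With m = k + 1, a monomial c in I^k is sought such that (I^m : v c) = P.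
    For x^b in P, the monomial v x^b lies in I, so that v c x^b lies in I^m
    whatever c is.  What is needed is a c for which v c x^b stays outside I^m
    for all b in D.  If there were none, then every c in I^k would satisfy
    v c x^b = d c' with b in D, d in I and c' in I^k.  Iterating this yields an
    infinite sequence c_0, c_1, ... of monomials of I^k, in which some c_i
    divides a later c_(i+r) by Dickson's lemma.  Multiplying the r equations in
    between and cancelling c_i gives v^r x^B in I^r with B in D, hence
    (v x^B)^r in I^r.  As I is integrally closed, v x^B lies in I and x^B in
    P, contradicting that B is in D.  This is the determinant trick for the localized inclusion
    v I^k <= I^(k+1), with a cycle of monomials in the role of the determinant
    ([integrally_closed_power_witness]).

    The statements about ideals are reduced to statements about sets of
    exponents by [monomial_genE] and [ideal_powE]. *)

(** * Dickson's lemma *)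

Section Dickson.

Lemma nat_has_argmin_after (f : nat -> nat) (N : nat) :
  exists2 t, (N <= t)%N & forall s, (N <= s)%N -> (f t <= f s)%N.
Proof.
have ex_val : exists x, `[< exists2 t, (N <= t)%N & f t = x >].
  by exists (f N); apply/asboolP; exists N.
case: (ex_minnP ex_val) => x /asboolP[t le_Nt ft_x] x_min.
exists t => // s le_Ns; rewrite ft_x; apply: x_min.
by apply/asboolP; exists s.
Qed.

(** Each term of the subsequence is the least value of f from there on. *)
Lemma nat_monotone_subsequence (f : nat -> nat) :
  exists2 phi : nat -> nat, {homo phi : i j / (i < j)%N}
    & {homo f \o phi : i j / (i <= j)%N}.
Proof.
have [next nextP] : {g : nat -> nat & forall N,
    (N <= g N)%N /\ forall s, (N <= s)%N -> (f (g N) <= f s)%N}.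
  apply: (@choice _ _ (fun N t =>
    (N <= t)%N /\ forall s, (N <= s)%N -> (f t <= f s)%N)) => N.
  by have [t] := nat_has_argmin_after f N; exists t.
pose phi := fix phi t := if t is s.+1 then next (phi s).+1 else next 0.
have phi_next t : exists N, phi t = next N by case: t => [|t]; eexists.
have phi_lt t : (phi t < phi t.+1)%N by have [] := nextP (phi t).+1.
have phi_homo : {homo phi : i j / (i < j)%N} by exact: homo_ltn ltn_trans phi_lt.
exists phi => // i j; rewrite leq_eqVlt => /predU1P[-> //|lt_ij] /=.
have [N phi_i] := phi_next i; rewrite phi_i; have [le_N] := nextP N; apply.
by apply: leq_trans le_N _; rewrite -phi_i ltnW // phi_homo.
Qed.

Lemma dickson_subsequence (n : nat) (c : nat -> 'X_{1..n}) (r : seq 'I_n) :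
  exists2 phi : nat -> nat, {homo phi : i j / (i < j)%N}
    & forall k, k \in r -> {homo (fun t => c (phi t) k) : i j / (i <= j)%N}.
Proof.
elim: r => [|k r [phi phi_lt phi_mono]]; first by exists id.
have [psi psi_lt psi_mono] := nat_monotone_subsequence (fun t => c (phi t) k).
exists (phi \o psi) => [i j lt_ij|l]; first by rewrite phi_lt ?psi_lt.
rewrite inE => /predU1P[-> //|l_r] i j; rewrite leq_eqVlt.
by case/predU1P=> [-> //|lt_ij]; apply: phi_mono => //=; rewrite ltnW ?psi_lt.
Qed.

Lemma dickson (n : nat) (c : nat -> 'X_{1..n}) :
  exists i j, (i < j)%N /\ (c i <= c j)%MM.
Proof.
have [phi phi_lt phi_mono] := dickson_subsequence c (enum 'I_n).
exists (phi 0), (phi 1); split; first exact: phi_lt.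
by apply/mnm_lepP => k; apply: (phi_mono k); rewrite ?mem_enum.
Qed.

End Dickson.

(** * Powers of a monomial ideal at the level of exponents *)

Section ExponentSets.
Variable n : nat.
Implicit Types (W D : set 'X_{1..n}) (u v a b c : 'X_{1..n}).

Definition upclosed W : Prop := forall u b, W u -> W (u + b)%MM.

Definition upset (A : set 'X_{1..n}) : set 'X_{1..n} :=
  [set u | exists2 a, A a & (a <= u)%MM].

Lemma upset_upclosed (A : set 'X_{1..n}) : upclosed (upset A).
Proof.
move=> u b [a Aa le_au]; exists a => //.
by apply: lepm_trans le_au _; apply: lem_addr.
Qed.

(** The exponents of the monomials of I^k when W is the set of those of I.  The
    power 0 is the whole set, matching the unit ideal; it makes every power of
    an upward closed W upward closed. *)
Fixpoint exp_pow W (k : nat) : set 'X_{1..n} :=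
  if k is k'.+1 then [set (a + b)%MM | a in W & b in exp_pow W k'] else setT.

Lemma exp_pow_up W k : upclosed W -> upclosed (exp_pow W k).
Proof.
move=> upW; elim: k => [//|k IHk] u b [a Wa [c Wc <-]].
by exists a => //; exists (c + b)%MM; [apply: IHk | rewrite addmA].
Qed.

(** The product of r consecutive equations v c_t x^b = d c_(t+1); the monomials
    c_t in between cancel. *)
Lemma exp_pow_chain W D v (c : nat -> 'X_{1..n}) :
    D 0%MM -> (forall a b, D a -> D b -> D (a + b)%MM) ->
    (forall t, exists b d, [/\ D b, W d & (v + c t + b = d + c t.+1)%MM]) ->
  forall i r, exists B d,
    [/\ D B, exp_pow W r d & (v *+ r + c i + B = d + c (i + r)%N)%MM].
Proof.
move=> D0 DD step i; elim=> [|r [B [d [DB Wd E]]]].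
  by exists 0%MM, 0%MM; split=> //; rewrite addn0 mulm0n addm0.
have [b [d' [Db Wd' E']]] := step (i + r)%N.
exists (B + b)%MM, (d' + d)%MM; split; first exact: DD.
  by exists d' => //; exists d.
apply/mnmP => j; move/mnmP/(_ j): E; move/mnmP/(_ j): E'.
by rewrite !mnmDE !mulmnE addnS; lia.
Qed.

(** The combinatorial core.  The second hypothesis is integral closedness, and
    the last one says that the colon of W by v is the complement of D; the
    conclusion is the same colon for the power k+1 of W.  The proof is the
    Dickson argument given at the top. *)
Lemma integrally_closed_power_witness W D v k :
    upclosed W ->
    (forall u r, (1 <= r)%N -> exp_pow W r (u *+ r)%MM -> W u) ->
    D 0%MM -> (forall a b, D a -> D b -> D (a + b)%MM) ->
    (forall b, W (v + b)%MM <-> ~ D b) ->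
  exists u, forall b, exp_pow W k.+1 (u + b)%MM <-> ~ D b.
Proof.
move=> upW icW D0 DD vW.
(* If W is empty, so are its positive powers and the complement of D. *)
have [[w Ww]|W0] := pselect (exists w, W w); last first.
  exists 0%MM => b; split=> [[a Wa]|/vW Wvb]; first by case: W0; exists a.
  by case: W0; exists (v + b)%MM.
suff [c Wc cD] : exists2 c, exp_pow W k c
    & forall b, D b -> ~ exp_pow W k.+1 (v + c + b)%MM.
  exists (v + c)%MM => b; split=> [Wb Db|nDb]; first exact: cD Db Wb.
  exists (v + b)%MM; first exact/vW.
  by exists c => //; apply/mnmP => j; rewrite !mnmDE; lia.
apply: contrapT => no_c.
have step (c : {c | exp_pow W k c}) : exists c' : {c | exp_pow W k c},
    exists b d, [/\ D b, W d & (v + sval c + b = d + sval c')%MM].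
  case: c => c Wc /=; apply: contrapT => no_c'; apply: no_c; exists c => // b Db.
  move=> [d Wd [c' Wc' E]]; apply: no_c'; exists (exist _ c' Wc'), b, d.
  by split.
have [next nextP] := choice step.
have w0 : exp_pow W k (w *+ k)%MM.
  elim: (k) => [//|j IHj]; exists w => //; exists (w *+ j)%MM => //.
  by rewrite mulmS.
pose c t := sval (iter t next (exist _ _ w0)).
have [i [j [lt_ij le_c]]] := dickson c.
have [B [d [DB Wd E]]] :=
  exp_pow_chain D0 DD (fun t => nextP (iter t next (exist _ _ w0))) i (j - i).
have r_gt0 : (1 <= j - i)%N by rewrite subn_gt0.
rewrite -/(c i) -/(c (i + (j - i))%N) subnKC 1?ltnW // in E.
suff: W (v + B)%MM by move/vW.
apply: (icW _ _ r_gt0); move: (j - i)%N r_gt0 Wd E => r r_gt0 Wd E.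
(* x^B is available once in the equation and is needed r times: the r - 1 extra
   factors, like the quotient c_j / c_i, are absorbed by upward closedness. *)
have -> : ((v + B) *+ r = d + (c j - c i + B *+ r.-1))%MM.
  apply/mnmP => l; move/mnmP/(_ l): E; move/mnm_lepP/(_ l): le_c.
  rewrite !(mulmnE, mnmDE, mnmBE).
  by case: r r_gt0 {Wd} => // r' _; lia.
exact: exp_pow_up.
Qed.

End ExponentSets.

Local Open Scope ring_scope.

(** * Monomial ideals as spans of exponent sets *)

Section MonomialSpan.
Variables (K : fieldType) (n : nat).
Implicit Types (W D : set 'X_{1..n}) (u v a b c : 'X_{1..n}).
Implicit Types (f g h : {mpoly K[n]}) (I P : set {mpoly K[n]}).

Definition mspan W : set {mpoly K[n]} :=
  [set g | forall u, u \in msupp g -> W u].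

Lemma mspanX W u : mspan W 'X_[u] <-> W u.
Proof.
split=> [|Wu a]; first by apply; rewrite msuppX inE.
by rewrite msuppX inE => /eqP->.
Qed.

Lemma mspanMX W g u :
  mspan W (g * 'X_[u]) <-> forall a, a \in msupp g -> W (u + a)%MM.
Proof.
split=> [Wg a ag|Wg b].
  by apply: Wg; rewrite (perm_mem (msuppMX g u)) map_f.
by rewrite (perm_mem (msuppMX g u)) => /mapP[a ag ->]; apply: Wg.
Qed.

Lemma mspanD W f g : mspan W f -> mspan W g -> mspan W (f + g).
Proof.
by move=> Wf Wg u /msuppD_le; rewrite mem_cat => /orP[/Wf|/Wg].
Qed.

Lemma mspanB W f g : mspan W f -> mspan W g -> mspan W (f - g).
Proof.
by move=> Wf Wg u /msuppB_le; rewrite mem_cat => /orP[/Wf|/Wg].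
Qed.

Lemma mspanM W g f : upclosed W -> mspan W f -> mspan W (g * f).
Proof.
move=> upW Wf u /msuppM_le/allpairsP[[a b] /= [_ bf ->]].
by rewrite addmC; apply: upW; apply: Wf.
Qed.

Lemma mspan_ideal W : upclosed W -> is_ideal (mspan W).
Proof.
move=> upW; split=> [|g f h]; first by rewrite inE => u; rewrite msupp0.
by rewrite !inE => Wf Wh; apply: mspanD => //; apply: mspanM.
Qed.

Lemma is_ideal_mspan (J : set {mpoly K[n]}) W :
  is_ideal J -> (forall u, W u -> J 'X_[u]) -> mspan W `<=` J.
Proof.
move=> [J0 JM] WJ g Wg; rewrite [g]mpolyE big_seq.
elim/big_rec: _ => [|u f ug Jf]; first by move: J0; rewrite inE.
have := JM (g@_u)%:MP 'X_[u] f; rewrite !inE mul_mpolyC.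
by apply=> //; apply/WJ/Wg.
Qed.

Lemma ideal_gen_ideal (G : set {mpoly K[n]}) : is_ideal (ideal_gen G).
Proof.
split=> [|g f h]; first by rewrite inE => J [[/set_mem]].
rewrite !inE => Gf Gh J [JI GJ]; have [_ JM] := JI.
by apply/set_mem/JM; apply/mem_set; [apply: Gf | apply: Gh].
Qed.

Lemma monomial_genE (A : set 'X_{1..n}) :
  monomial_gen (K := K) A = mspan (upset A).
Proof.
apply/seteqP; split.
  apply: smallest_sub => [|_ [a Aa <-]].
    exact/mspan_ideal/upset_upclosed.
  by apply/mspanX; exists a => //; apply: lepm_refl.
apply: is_ideal_mspan; first exact: ideal_gen_ideal.
move=> u [a Aa le_au]; rewrite -(submK le_au) mpolyXD -[_ * _]addr0.
have [J0 JM] := ideal_gen_ideal [set 'X_[K, u] | u in A].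
apply/set_mem/JM => //; apply/mem_set.
by apply: sub_gen_smallest; exists a.
Qed.

Lemma ideal_powE W m : upclosed W ->
  ideal_pow (mspan W) m = mspan (exp_pow W m).
Proof.
move=> upW; apply/seteqP; split.
  apply: smallest_sub => [|_ [h Wh ->]]; first exact/mspan_ideal/exp_pow_up.
  elim: m h Wh => [|m IHm] h Wh u //=.
  rewrite big_ord_recl => /msuppM_le/allpairsP[[a b] /= [ah bh ->]].
  exists a; first exact: Wh ah.
  by exists b => //; apply: IHm bh => i; apply: Wh.
apply: is_ideal_mspan => [|u Wu]; first exact: ideal_gen_ideal.
suff [h [Wh [g ->]]] : exists h : 'I_m -> {mpoly K[n]},
    (forall i, mspan W (h i)) /\ exists g, 'X_[u] = g * \prod_(i < m) h i.
  have [J0 JM] := ideal_gen_ideal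
    [set f | exists2 h : 'I_m -> _, forall i, mspan W (h i)
                                  & f = \prod_(i < m) h i].
  rewrite -[_ * _]addr0; apply/set_mem/JM => //; apply/mem_set.
  by apply: sub_gen_smallest; exists h.
elim: m u Wu => [|m IHm] u /=.
  move=> _; exists (fun=> 0); split; first by case.
  by exists 'X_[u]; rewrite big_ord0 mulr1.
move=> [a Wa [b /IHm[h [Wh [g E]]] <-]].
exists (fun i => if unlift ord0 i is Some j then h j else 'X_[a]); split.
  by move=> i; case: unliftP => [j _|_] //; apply/mspanX.
exists g; rewrite mpolyXD E big_ord_recl unlift_none mulrCA; congr (_ * (_ * _)).
by apply: eq_bigr => i _; rewrite liftK.
Qed.

End MonomialSpan.

(** * Associated primes of a monomial ideal *)

Lemma prime_ideal_not1 (R : comNzRingType) (P : set R) :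
  is_prime_ideal P -> ~ P 1.
Proof. by move=> [[_ P1 _] _] /mem_set P1'; rewrite P1' in P1. Qed.

Lemma prime_ideal_mul (R : comNzRingType) (P : set R) (g h : R) :
  is_prime_ideal P -> P (g * h) -> P g \/ P h.
Proof.
by move=> [_ Pprime] /mem_set/Pprime/orP[/set_mem|/set_mem]; [left | right].
Qed.

Section AssociatedPrimes.
Variables (K : fieldType) (n : nat).
Implicit Types (W D : set 'X_{1..n}) (u v a b c : 'X_{1..n}).
Implicit Types (f g h : {mpoly K[n]}) (I P : set {mpoly K[n]}).

Lemma size_msupp_tail f : f != 0 ->
  (size (msupp (f - f@_(mlead f) *: 'X_[mlead f])) < size (msupp f))%N.
Proof.
move=> f0; have lf := mlead_supp f0.
by rewrite (perm_size (msupp_rem f _)) size_rem // prednK //; case: msupp lf.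
Qed.

(** The product of the leading terms of g and f lies in I, so multiplying by
    x^a, for a the leading exponent of g, lets f lose its leading term modulo I;
    the shortened f is still killed by g, whence the induction on the number of
    terms of f. *)
Lemma mlead_power_annihilates W f g : upclosed W -> g != 0 ->
  mspan W (g * f) -> exists N, mspan W ('X_[mlead g] ^+ N * f).
Proof.
move=> upW g0; have [s] := ubnP (size (msupp f)).
elim: s f => [//|s IHs] f; rewrite ltnS => le_fs Wgf.
have [->|f0] := eqVneq f 0; first by exists 0; rewrite mulr0 => u; rewrite msupp0.
set a := mlead g; set b := mlead f; pose f1 := f - f@_b *: 'X_[b].
have Wab : mspan W ('X_[a] * (f@_b *: 'X_[b])).
  rewrite -scalerAr -mpolyXD => u /msuppZ_le; rewrite msuppX inE => /eqP->.
  by apply: Wgf; rewrite -mleadM // mlead_supp // mulf_neq0.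
have [||N WN] := IHs ('X_[a] * f1).
- rewrite mulrC (perm_size (msuppMX _ _)) size_map.
  exact: leq_trans (size_msupp_tail f0) le_fs.
- rewrite mulrCA /f1 !mulrBr.
  apply: mspanB; first exact: mspanM.
  by rewrite mulrCA; apply: mspanM.
exists N.+1; rewrite exprSr -mulrA.
have -> : 'X_[a] * f = 'X_[a] * f1 + 'X_[a] * (f@_b *: 'X_[b]).
  by rewrite -mulrDr subrK.
by rewrite mulrDr; apply: mspanD => //; apply: mspanM.
Qed.

(** If g is in P, a power of its leading monomial is in P by
    [mlead_power_annihilates], hence so is that monomial, P being prime; the
    other monomials of g follow by subtracting the leading term. *)
Lemma prime_ann_mspan W P f : upclosed W -> is_prime_ideal P ->
  P = ann_quot (mspan W) f -> P = mspan [set a | P 'X_[a]].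
Proof.
move=> upW Pp PE; have [[P0 _ PM] _] := Pp.
have P_ideal : is_ideal P by split.
have PX N h : P (h ^+ N) -> P h.
  elim: N => [/prime_ideal_not1 //|N IHN].
  by rewrite exprS => /(prime_ideal_mul Pp)[].
apply/seteqP; split; last by apply: is_ideal_mspan.
move=> g; have [s] := ubnP (size (msupp g)).
elim: s g => [//|s IHs] g; rewrite ltnS => le_gs Pg.
have [->|g0] := eqVneq g 0; first by move=> u; rewrite msupp0.
have Pa : P 'X_[mlead g].
  have [N WN] : exists N, mspan W ('X_[mlead g] ^+ N * f).
    by apply: mlead_power_annihilates => //; move: Pg; rewrite PE.
  by apply: (@PX N); rewrite PE.
rewrite -[g](subrK (g@_(mlead g) *: 'X_[mlead g])); apply: mspanD.
  apply: IHs; first exact: leq_trans (size_msupp_tail g0) le_gs.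
  rewrite addrC -scaleNr -mul_mpolyC.
  by apply/set_mem/PM; apply/mem_set.
by move=> u /msuppZ_le; rewrite msuppX inE => /eqP->.
Qed.

(** Otherwise each monomial x^v of f would have some x^b outside P with
    x^(v+b) in I; the product of these x^b over all v would annihilate f modulo
    I, hence lie in the prime P. *)
Lemma prime_ann_monomial W P f : upclosed W -> is_prime_ideal P ->
  P = ann_quot (mspan W) f ->
  exists v, forall b, W (v + b)%MM <-> P 'X_[b].
Proof.
move=> upW Pp PE.
suff [v vf vP] : exists2 v, v \in msupp f & forall b, W (v + b)%MM -> P 'X_[b].
  exists v => b; split; first exact: vP.
  rewrite PE /ann_quot /= mulrC => /mspanMX/(_ _ vf).
  by rewrite addmC.
apply: contrapT => no_v.
have {no_v} kill v : v \in msupp f ->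
    exists b, W (v + b)%MM /\ ~ P 'X_[b].
  move=> vf; apply: contrapT => no_b; apply: no_v; exists v => // b Wb.
  by apply: contrapT => nPb; apply: no_b; exists b.
suff [b [Wb]] : exists b, (forall v, v \in msupp f -> W (v + b)%MM) /\ ~ P 'X_[b].
  rewrite PE; apply; rewrite /ann_quot /= mulrC.
  by apply/mspanMX => v /Wb; rewrite addmC.
have: {subset msupp f <= msupp f} by [].
elim: {1 3}(msupp f) => [_|v r IHr rf].
  by exists 0%MM; split=> //; rewrite mpolyX0; apply: prime_ideal_not1.
have [|b [Wb nPb]] := IHr; first by move=> x xr; apply: rf; rewrite inE xr orbT.
have [|b' [Wb' nPb']] := kill v; first by apply: rf; rewrite inE eqxx.
exists (b' + b)%MM; split=> [x|].
  rewrite inE addmA => /predU1P[->|/Wb Wxb]; first exact: upW.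
  by rewrite -addmA [(b' + b)%MM]addmC addmA; apply: upW.
by rewrite mpolyXD => /(prime_ideal_mul Pp)[].
Qed.

End AssociatedPrimes.

Theorem corollary4p7 (K : fieldType) (n : nat) (I : set {mpoly K[n]})
    (I_monomial : is_monomial_ideal I) (I_closed : integrally_closed I)
    (m : nat) (m_ge1 : (1 <= m)%N) :
  Ass_quot I `<=` Ass_quot (ideal_pow I m).
Proof.
case: I_monomial => A IA.
pose W := upset A; have upW : upclosed W := @upset_upclosed n A.
have IW : I = mspan (K := K) W by rewrite IA monomial_genE.
have icW u r : (1 <= r)%N -> exp_pow W r (u *+ r)%MM -> W u.
  move=> r_ge1 Wr; apply/(mspanX K); rewrite -IW I_closed.
  apply: sub_gen_smallest; exists u => //; exists r => //.
  by rewrite IW ideal_powE // mpolyXn; apply/mspanX.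
move=> P [Pp [f PE]]; split=> //; rewrite IW in PE *.
have PP := prime_ann_mspan upW Pp PE.
have [v vP] := prime_ann_monomial upW Pp PE.
case: m m_ge1 => // k _.
pose D : set 'X_{1..n} := [set b | ~ P 'X_[b]].
have D0 : D 0%MM by rewrite /D /= mpolyX0; apply: prime_ideal_not1.
have DD a b : D a -> D b -> D (a + b)%MM.
  by move=> Da Db; rewrite /D /= mpolyXD => /(prime_ideal_mul Pp)[].
have vD b : W (v + b)%MM <-> ~ D b by rewrite /D /= notK.
have [u uD] := integrally_closed_power_witness k upW icW D0 DD vD.
exists 'X_[u]; rewrite {1}PP ideal_powE //; apply/seteqP; split=> g.
  by move=> Pg; apply/mspanMX => a ag; apply/uD; rewrite /D /= notK; apply: Pg.
by move/mspanMX => Wg a /Wg/uD; rewrite /D /= notK.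
Qed.
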